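(* Let $r\le s\le t$ be positive integers and $k\le r$. The number of critical $k$-cells of the acyclic matching on $\mathrm{Hom}(r,s,t)$ described below is $\binom{r}{k}\binom{s}{k}\binom{t}{k}$.
   Context: $C_k$ is the chain $0<1<\cdots<k$. For $\mathbf{i}=(i_1,\ldots,i_n)$ with $1\le i_1\le\cdots\le i_n$ and $\ell=\sum i_j$, $\mathrm{Hom}(\mathbf{i})=\mathrm{Hom}(C_\ell,\prod_j C_{i_j})$ is the cubical complex whose cells are the tuples $(X_0,\ldots,X_\ell)$ of nonempty subsets of $\prod_jC_{i_j}$ such that every choice $x_p\in X_p$ gives a strictly increasing (hence maximal) chain. Vertices (maximal chains) are encoded by words that are permutations of the multiset $\{1^{i_1},\ldots,n^{i_n}\}$ (the $p$-th letter is the coordinate increased at step $p$). A $k$-cell is encoded by such a word in which $k$ non-overlapping adjacent pairs of distinct letters are enclosed in parentheses, each pair written in decreasing order (letters in a pair are ''joined'', others ''free''); its vertices are obtained by writing each pair in either order, and its facets are obtained by releasing one pair in either order. $\mathrm{Hom}(r,s,t)$ is the case $\mathbf{i}=(r,s,t)$. For a cell $\sigma$ with underlying word $\sigma_1\cdots\sigma_\ell$, let $r_s$ denote the $s$-th occurrence of letter $r$ from the left and $j_{r,s}(\sigma)$ its position. The matching is produced as follows: set $\Omega$ equal to the set of all cells, and process the pairs $(r,s)$ in the order $(n,i_n),(n,i_n-1),\ldots,(n,1),(n-1,i_{n-1}),\ldots,(1,1)$. At step $(r,s)$, a cell $\sigma\in\Omega$ with $j=j_{r,s}(\sigma)$ is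 of type $a$ if (1) if $\sigma_{j-1}$ exists and is free then $r\ge\sigma_{j-1}$; (2) $\sigma_{j+1}$ exists and $r>\sigma_{j+1}$; (3) $r_s$ and $\sigma_{j+1}$ are either both free or joined to each other. Each type-$a$ cell in which $r_s,\sigma_{j+1}$ are free is matched with the cell obtained by joining them; all type-$a$ cells are then removed from $\Omega$. The cells remaining in $\Omega$ after step $(1,1)$ are the critical cells; this matching is acyclic. *)

(* Defs.v *)
From HB Require Import structures.
From mathcomp Require Import all_boot.

Set Implicit Arguments.
Unset Strict Implicit.
Unset Printing Implicit Defensive.

(* Coordinates, letters and positions are numbered from 0: the letter "j + 1"
   of the multiset {1^(i_1), ..., n^(i_n)} is j : 'I_n.  The occurrence number
   s of an occurrence r_s is counted from 1. *)

Section HomComplex.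

Variables (n : nat) (i : n.-tuple nat).

Definition len : nat := \sum_(j < n) tnth i j.

(* The product of the chains C_(i_j), C_k being 'I_k.+1. *)
Definition chain_prod : finType := {dffun forall j : 'I_n, 'I_(tnth i j).+1}.

Definition prod_lt (x y : chain_prod) : bool :=
  [forall j, x j <= y j] && (x != y).

Definition strictly_increasing (x : {ffun 'I_len.+1 -> chain_prod}) : bool :=
  [forall p : 'I_len.+1, forall q : 'I_len.+1, (p < q) ==> prod_lt (x p) (x q)].

Definition hom_tuple : finType := {ffun 'I_len.+1 -> {set chain_prod}}.

Definition Hom : {set hom_tuple} :=
  [set X : hom_tuple |
    [forall p, X p != set0] &&
    [forall x : {ffun 'I_len.+1 -> chain_prod},
        [forall p, x p \in X p] ==> strictly_increasing x]].

(* A cell (X_0, ..., X_len) is the product of the simplices with vertex sets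
   X_p. *)
Definition cell_dim (X : hom_tuple) : nat := \sum_p #|X p|.-1.

(* A pair (w, m) is a word w with parentheses recorded by m: the letters at
   positions q and q + 1 are enclosed together when m is true at q. *)
Definition word : finType := len.-tuple 'I_n.
Definition pword : finType := (word * len.-tuple bool)%type.

(* The default value n, for q out of range, is never relevant below. *)
Definition letter (w : word) (q : nat) : nat := nth n (map val w) q.

Definition is_word (w : word) : bool :=
  [forall j : 'I_n, count_mem j w == tnth i j].

Definition opens (c : pword) (q : nat) : bool := nth false c.2 q.
Definition closes (c : pword) (q : nat) : bool := (0 < q) && opens c q.-1.
Definition free (c : pword) (q : nat) : bool := ~~ opens c q && ~~ closes c q.

Definition is_pword (c : pword) : bool :=
  is_word c.1 &&
  [forall q : 'I_len, opens c q ==>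
     [&& q.+1 < len, letter c.1 q.+1 < letter c.1 q & ~~ opens c q.+1]].

(* The element of rank p of the maximal chain encoded by w; for a w satisfying
   is_word the counts are in range and inord does not truncate. *)
Definition chain_elt (w : word) (p : nat) : chain_prod :=
  [ffun j => inord (count_mem j (take p w))].

(* u is obtained from c by writing each pair in either order. *)
Definition is_vertex (c : pword) (u : word) : bool :=
  [forall q : 'I_len,
     if opens c q then
       (letter u q, letter u q.+1) \in
         [:: (letter c.1 q, letter c.1 q.+1); (letter c.1 q.+1, letter c.1 q)]
     else free c q ==> (letter u q == letter c.1 q)].

Definition cell_of (c : pword) : hom_tuple :=
  [ffun p : 'I_len.+1 => [set chain_elt u p | u : word & is_vertex c u]].

Definition encodes (c : pword) (X : hom_tuple) : bool :=
  is_pword c && (X == cell_of c).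

(* j_{r,s}, the position of the s-th occurrence of r, for 1 <= s <= i_r. *)
Definition occ_pos (w : word) (r : 'I_n) (s : nat) : nat :=
  nth len [seq q <- iota 0 len | letter w q == r] s.-1.

Definition type_a_pword (r : 'I_n) (s : nat) (c : pword) : bool :=
  let j := occ_pos c.1 r s in
  [&& (0 < j) && free c j.-1 ==> (letter c.1 j.-1 <= r),
      (j.+1 < len) && (letter c.1 j.+1 < r)
    & free c j && free c j.+1 || opens c j].

Definition type_a (r : 'I_n) (s : nat) (X : hom_tuple) : bool :=
  [exists c : pword, encodes c X && type_a_pword r s c].

(* (n, i_n), ..., (n, 1), (n - 1, i_(n-1)), ..., (1, 1) *)
Definition steps : seq ('I_n * nat) :=
  [seq (r, s) | r <- rev (enum 'I_n), s <- rev (iota 1 (tnth i r))].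

(* The type-a cells at each step are matched among themselves (by joining or
   releasing r_s and the next letter), so the unmatched cells are those that
   survive the removals. *)
Definition critical_cells : {set hom_tuple} :=
  foldl (fun (Omega : {set hom_tuple}) rs =>
           [set X in Omega | ~~ type_a rs.1 rs.2 X])
        Hom steps.

End HomComplex.

(* Main.v *)
(** In a cell of Hom(i) an X_p with two elements forces X_(p-1) and X_(p+1) to
    be their meet and join, so cells correspond bijectively to parenthesized
    words, and the critical ones are the words with no type-a position.  In such
    a word no descent is formed by two free letters (the leftmost one would be of
    type a), and every pair (ab) is preceded by a free letter larger than a.
    With three letters every pair is thus 2(10), numbering letters from 0, and
    the remaining letters form weakly increasing blocks between these patterns;
    such words are recognized by a condition on consecutive letters, which
    yields a Pascal-type recurrence for their number. *)
Require Import Defs.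
From mathcomp Require Import all_boot zify.

Set Implicit Arguments.
Unset Strict Implicit.
Unset Printing Implicit Defensive.

(** * Words and the coordinates of their chains *)

Section Encoding.

Variables (n : nat) (i : n.-tuple nat).
Implicit Types (w u : word i) (c : pword i) (X : hom_tuple i).

(** For a word of the right content this is coordinate [a] of the chain element of rank [p], freed
    from the dependent type and from [inord]; chain elements are compared through it from here
    on. *)
Definition prefix_count w (p a : nat) : nat :=
  count_mem a (take p (map val w)).

Lemma size_letters w : size (map val w) = len i.
Proof. by rewrite size_map size_tuple. Qed.

Lemma prefix_count0 w a : prefix_count w 0 a = 0.
Proof. by rewrite /prefix_count take0. Qed.

Lemma prefix_countS w q a : q < len i ->
  prefix_count w q.+1 a = prefix_count w q a + (letter w q == a).
Proof.
move=> ltq; rewrite /prefix_count (take_nth n) ?size_letters //.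
by rewrite -cats1 count_cat /= addn0.
Qed.

Lemma letter_lt w q : q < len i -> letter w q < n.
Proof.
move=> ltq; have: letter w q \in map val w by rewrite mem_nth ?size_letters.
by case/mapP=> j _ ->; apply: ltn_ord.
Qed.

Lemma letter_tnth w (q : 'I_(len i)) : letter w q = tnth w q.
Proof.
rewrite /letter (nth_map (tnth w q)) ?size_tuple //.
by rewrite -tnth_nth.
Qed.

Lemma eq_word w u : (forall q, q < len i -> letter w q = letter u q) -> w = u.
Proof.
by move=> eqwu; apply: eq_from_tnth => q; apply: val_inj; rewrite /= -!letter_tnth eqwu.
Qed.

Lemma count_prefix w (j : 'I_n) p :
  count_mem j (take p w) = prefix_count w p j.
Proof. by rewrite /prefix_count -map_take count_map; apply: eq_count => x /=. Qed.

Lemma is_wordE w :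
  is_word w = [forall j : 'I_n, prefix_count w (len i) j == tnth i j].
Proof. by apply: eq_forallb => j; rewrite -count_prefix take_oversize ?size_tuple. Qed.

Lemma prefix_count_leq w p q a : p <= q -> prefix_count w p a <= prefix_count w q a.
Proof.
move=> lepq; rewrite /prefix_count -(subnKC lepq) takeD count_cat; exact: leq_addr.
Qed.

Lemma chain_eltE w p (j : 'I_n) : is_word w ->
  chain_elt w p j = prefix_count w p j :> nat.
Proof.
rewrite is_wordE => /forallP /(_ j) /eqP wj.
rewrite ffunE count_prefix inordK // ltnS -wj /prefix_count -[X in _ <= X]/(count_mem _ _).
rewrite (@take_oversize _ (len i)) ?size_letters //.
by rewrite -{2}(cat_take_drop p (map val w)) count_cat leq_addr.
Qed.

Lemma chain_elt_eq w u p q : is_word w -> is_word u ->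
  (chain_elt w p = chain_elt u q) <->
  (forall a, a < n -> prefix_count w p a = prefix_count u q a).
Proof.
move=> ww wu; split=> [eqwu a lta|eqwu].
  have /(congr1 val) := congr1 (fun f : chain_prod i => f (Ordinal lta)) eqwu.
  by rewrite /= !chain_eltE.
by apply/ffunP=> j; apply: val_inj; rewrite /= !chain_eltE ?eqwu.
Qed.

(** * Vertices of a parenthesized word *)

Definition well_opened c q :=
  [&& q.+1 < len i, letter c.1 q.+1 < letter c.1 q & ~~ opens c q.+1].

Lemma opens_lt c q : opens c q -> q < len i.
Proof.
by rewrite /opens; case: ltnP => // leq; rewrite nth_default ?size_tuple.
Qed.

Lemma pword_opens c q : is_pword c -> opens c q -> well_opened c q.
Proof.
case/andP=> _ /forallP cP oq; have ltq := opens_lt oq.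
exact: (implyP (cP (Ordinal ltq))).
Qed.

Lemma pword_closes c p : is_pword c -> closes c p -> ~~ opens c p /\ p < len i.
Proof. by case: p => // p cP /andP [_ /(pword_opens cP) /and3P []]. Qed.

Lemma pword_word c : is_pword c -> is_word c.1. Proof. by case/andP. Qed.

Lemma vertexP c u : is_vertex c u ->
  (forall q, opens c q ->
     (letter u q = letter c.1 q /\ letter u q.+1 = letter c.1 q.+1) \/
     (letter u q = letter c.1 q.+1 /\ letter u q.+1 = letter c.1 q)) /\
  (forall q, q < len i -> free c q -> letter u q = letter c.1 q).
Proof.
move=> /forallP uP; split=> [q oq|q ltq fq].
  have := uP (Ordinal (opens_lt oq)); rewrite /= oq !inE /=.
  by case/orP=> /eqP [-> ->]; [left|right].
have := uP (Ordinal ltq); rewrite /= fq /= (negPf (proj1 (andP fq))).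
by move/eqP.
Qed.

Lemma vertex_refl c : is_vertex c c.1.
Proof.
by apply/forallP=> q; case: ifP => _; rewrite ?inE ?eqxx // implybT.
Qed.

(** Reordering a pair changes a prefix count only when the prefix ends between its two letters, and
    [closes c p] describes exactly this. The induction is strong because a pair is crossed two
    letters at a time. *)
Lemma vertex_prefix c u p a : is_pword c -> is_vertex c u -> p <= len i ->
  ~~ closes c p -> prefix_count u p a = prefix_count c.1 p a.
Proof.
move=> cP /vertexP [uo uf]; elim/ltn_ind: p => -[|p] IH lep ncl.
  by rewrite !prefix_count0.
have np : ~~ opens c p by [].
have [clp|nclp] := boolP (closes c p); last first.
  rewrite !prefix_countS // IH ?(ltnW lep) // uf //.
  by rewrite /free np nclp.
case: p clp np lep {ncl} IH => // p /andP [_ op] np lep IH.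
rewrite !prefix_countS ?(ltnW lep) // IH ?(ltnW (ltnW lep)) //; last first.
  by apply/negP=> /(pword_closes cP) []; move: op => /= ->.
by case: (uo _ op) => -[-> ->] //; rewrite addnAC.
Qed.

Lemma vertex_word c u : is_pword c -> is_vertex c u -> is_word u.
Proof.
move=> cP uP; move: (pword_word cP); rewrite !is_wordE => /forallP cw.
apply/forallP=> j; rewrite (vertex_prefix _ cP) //.
by apply/negP=> /(pword_closes cP) []; rewrite ltnn.
Qed.

Definition swap_letters w (p q : 'I_(len i)) : word i :=
  [tuple if x == p then tnth w q else if x == q then tnth w p else tnth w x
    | x < len i].

Lemma letter_swap w (p q x : 'I_(len i)) :
  letter (swap_letters w p q) x =
  if x == p then letter w q else if x == q then letter w p else letter w x.
Proof. by rewrite !letter_tnth tnth_mktuple; do 2?case: ifP. Qed.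

Lemma vertex_swap c q : is_pword c -> opens c q -> exists u,
  [/\ is_vertex c u, letter u q = letter c.1 q.+1 & letter u q.+1 = letter c.1 q].
Proof.
move=> cP oq; have /and3P [ltq1 ltl nq1] := pword_opens cP oq.
have ltq := ltnW ltq1.
pose p0 := Ordinal ltq; pose p1 := Ordinal ltq1.
pose u := swap_letters c.1 p0 p1.
have uE x : x < len i -> letter u x = if x == q then letter c.1 q.+1
    else if x == q.+1 then letter c.1 q else letter c.1 x.
  by move=> ltx; rewrite -[x]/(val (Ordinal ltx)) letter_swap -!val_eqE.
exists u; split; rewrite ?uE ?eqxx // ?gtn_eqF //.
apply/forallP=> x; have [xq|nxq] := eqVneq (x : nat) q.
  by rewrite xq oq !uE // eqxx gtn_eqF // eqxx !inE eqxx orbT.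
have [xq1|nxq1] := eqVneq (x : nat) q.+1.
  by rewrite xq1 (negPf nq1) /free /closes /= oq andbF.
have uxE: letter u x = letter c.1 x by rewrite uE // (negPf nxq) (negPf nxq1).
case: ifP => [ox|_]; last by rewrite uxE eqxx implybT.
have /and3P [ltx1 _ nx1] := pword_opens cP ox.
have nxx: x.+1 != q by apply: contraNneq nx1 => ->.
by rewrite uxE uE // eqSS (negPf nxq) (negPf nxx) inE eqxx.
Qed.

(** * From parenthesized words to cells *)

Lemma cell_of_free c (p : 'I_(len i).+1) : is_pword c -> ~~ closes c p ->
  cell_of c p = [set chain_elt c.1 p].
Proof.
move=> cP ncl; rewrite ffunE; apply/setP=> y; rewrite inE; apply/imsetP/eqP.
  case=> u; rewrite inE => uP ->; apply/chain_elt_eq; first exact: vertex_word uP.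
    exact: pword_word.
  by move=> a _; apply: vertex_prefix => //; rewrite -ltnS.
by move=> ->; exists c.1 => //; rewrite inE vertex_refl.
Qed.

(** Every vertex writes the pair at [q] either as [c.1] does or as [u] does, and reordering other
    pairs leaves the prefix of length [q] unchanged in content. The two elements differ in
    coordinate [letter c.1 q]. *)
Lemma cell_of_pair c q (p : 'I_(len i).+1) : is_pword c -> opens c q ->
    p = q.+1 :> nat -> exists u,
  [/\ is_vertex c u, letter u q = letter c.1 q.+1,
      cell_of c p = [set chain_elt c.1 p; chain_elt u p] &
      chain_elt c.1 p != chain_elt u p].
Proof.
move=> cP oq pE; have [u [uP uq uq1]] := vertex_swap cP oq.
have ltq := opens_lt oq.
have /and3P [ltq1 ltl nq1] := pword_opens cP oq.
have ncl : ~~ closes c q by apply/negP => /(pword_closes cP) []; rewrite oq.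
exists u; split=> //; last first.
  apply/eqP=> /chain_elt_eq => /(_ (pword_word cP) (vertex_word cP uP)).
  move=> /(_ (letter c.1 q) (letter_lt _ ltq)); rewrite pE !prefix_countS //.
  rewrite (vertex_prefix _ cP uP) ?(ltnW ltq) // uq; lia.
rewrite ffunE; apply/setP=> y; rewrite !inE; apply/imsetP/orP; last first.
  case=> /eqP ->; last by exists u; rewrite ?inE.
  by exists c.1; rewrite ?inE ?vertex_refl.
case=> v; rewrite inE => vP ->; have [vo _] := vertexP vP.
have [[vq _]|[vq _]] := vo _ oq; [left|right]; apply/eqP/chain_elt_eq;
  rewrite ?(vertex_word cP vP) ?(vertex_word cP uP) ?pword_word // => a _;
  rewrite pE !prefix_countS // ?vq ?uq; congr (_ + _);
  by rewrite ?(vertex_prefix _ cP vP) ?(vertex_prefix _ cP uP) // ltnW.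
Qed.

Lemma prod_lt_trans : transitive (@prod_lt n i).
Proof.
move=> y x z /andP [/forallP xy nxy] /andP [/forallP yz nyz].
apply/andP; split; first by apply/forallP=> j; apply: leq_trans (yz j).
apply: contraNneq nxy => xz; apply/eqP/ffunP=> j; apply/val_inj/eqP.
by rewrite eqn_leq xy /= xz yz.
Qed.

Lemma strictly_increasingP (x : {ffun 'I_(len i).+1 -> chain_prod i}) :
  (forall p q : 'I_(len i).+1, q = p.+1 :> nat -> prod_lt (x p) (x q)) ->
  strictly_increasing x.
Proof.
move=> xP; apply/forallP=> p; apply/forallP=> -[q ltq]; apply/implyP=> /=.
elim: q ltq => // q IH ltq; have ltq' := ltnW ltq.
have step := xP (Ordinal ltq') (Ordinal ltq) erefl.
rewrite ltnS leq_eqVlt => /orP [/eqP pq|ltpq].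
  by have -> : p = Ordinal ltq' by apply: val_inj.
exact: prod_lt_trans (IH ltq' ltpq) step.
Qed.

Lemma chain_elt_lt w p : is_word w -> p < len i ->
  prod_lt (chain_elt w p) (chain_elt w p.+1).
Proof.
move=> ww ltp; apply/andP; split.
  by apply/forallP=> j; rewrite !chain_eltE // prefix_count_leq.
apply/eqP=> /chain_elt_eq => /(_ ww ww (letter w p) (letter_lt _ ltp)).
by rewrite prefix_countS // eqxx; lia.
Qed.

(** Pairs do not overlap, so of two consecutive ranks at least one lies outside the interior of any
    pair. There all vertices agree, hence both chosen elements lie on the chain of a single
    vertex. *)
Lemma cell_of_Hom c : is_pword c -> cell_of c \in Hom i.
Proof.
move=> cP; rewrite inE; apply/andP; split.
  apply/forallP=> p; rewrite ffunE; apply/set0Pn; exists (chain_elt c.1 p).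
  by apply/imsetP; exists c.1; rewrite ?inE ?vertex_refl.
apply/forallP=> x; apply/implyP=> /forallP xP.
apply: strictly_increasingP => p q qE.
have ltp : p < len i by rewrite -ltnS -qE.
have /imsetP [u] : x p \in [set chain_elt u p | u : word i & is_vertex c u].
  by have := xP p; rewrite ffunE.
rewrite inE => uP ->.
have /imsetP [v] : x q \in [set chain_elt u q | u : word i & is_vertex c u].
  by have := xP q; rewrite ffunE.
rewrite inE => vP ->; rewrite qE.
have uw := vertex_word cP uP; have vw := vertex_word cP vP.
have [/(pword_closes cP) [np _]|nclp] := boolP (closes c p).
  suff -> : chain_elt v p.+1 = chain_elt u p.+1 by apply: chain_elt_lt.
  apply/chain_elt_eq => // a _.
  by rewrite (vertex_prefix _ cP vP) // (vertex_prefix _ cP uP).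
suff -> : chain_elt u p = chain_elt v p by apply: chain_elt_lt.
apply/chain_elt_eq => // a _.
by rewrite (vertex_prefix _ cP vP) ?(vertex_prefix _ cP uP) // ltnW.
Qed.

Lemma card_cell_of c (p : 'I_(len i).+1) : is_pword c ->
  #|cell_of c p| = (closes c p).+1.
Proof.
move=> cP; have [clp|nclp] := boolP (closes c p); last first.
  by rewrite cell_of_free // cards1.
have /andP [p_gt0 op] := clp.
have [u [_ _ -> neq]] := cell_of_pair cP op (esym (prednK p_gt0)).
by rewrite cards2 neq.
Qed.

Lemma cell_dim_cell_of c : is_pword c -> cell_dim (cell_of c) = count id c.2.
Proof.
move=> cP; rewrite /cell_dim; under eq_bigr do rewrite card_cell_of //=.
rewrite big_ord_recl /= add0n -sum1_count [RHS]big_mkcond [RHS]big_tuple /=.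
by apply: eq_bigr => q _; rewrite /closes /opens /= add0n -tnth_nth; case: (tnth c.2 q).
Qed.

(** The cardinalities of the X_p recover the parentheses, the singletons recover the prefix counts
    at the ends of pairs, and the decreasing order inside a pair decides which of the two elements
    belongs to the word. *)
Lemma cell_of_inj : {in @is_pword n i &, injective (@cell_of n i)}.
Proof.
move=> c d cP dP eqcd.
have eqcl (p : 'I_(len i).+1) : closes c p = closes d p.
  have := card_cell_of p cP; rewrite eqcd (card_cell_of p dP).
  by case: closes; case: closes.
have eqo q : opens c q = opens d q.
  case: (ltnP q (len i)) => [ltq|leq]; last first.
    by rewrite /opens !nth_default ?size_tuple.
  by have := eqcl (Ordinal (ltq : q.+1 < (len i).+1)).
have eq2 : c.2 = d.2.
  by apply: eq_from_tnth => q; rewrite !(tnth_nth false); apply: eqo.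
have cw := pword_word cP; have dw := pword_word dP.
have pre p a : a < n -> p <= len i -> ~~ closes c p ->
    prefix_count c.1 p a = prefix_count d.1 p a.
  move=> lta; rewrite -ltnS => ltp ncl; pose p' := Ordinal ltp.
  have := congr1 (fun f : hom_tuple i => f p') eqcd.
  rewrite !cell_of_free -?(eqcl p') // => /set1_inj /chain_elt_eq -> //.
have pair q : opens c q -> letter c.1 q = letter d.1 q.
  move=> oq; have ltq := opens_lt oq.
  have [ltq1 ltl nq1] := and3P (pword_opens cP oq).
  have od : opens d q by rewrite -eqo.
  have [_ ltld _] := and3P (pword_opens dP od).
  have ncl : ~~ closes c q by apply/negP => /(pword_closes cP) []; rewrite oq.
  pose p : 'I_(len i).+1 := Ordinal (ltq : q.+1 < (len i).+1).
  have same (u v : word i) : is_word u -> is_word v ->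
      (forall a, a < n -> prefix_count u q a = prefix_count v q a) ->
      chain_elt u p = chain_elt v p -> letter u q = letter v q.
    move=> uw vw equv /chain_elt_eq => /(_ uw vw).
    move=> /(_ (letter u q) (letter_lt _ ltq)); rewrite !prefix_countS //.
    by rewrite equv ?letter_lt // eqxx => /addnI; case: eqP.
  have [u [uP uq cE _]] := cell_of_pair (p := p) cP oq erefl.
  have [v [vP vq dE _]] := cell_of_pair (p := p) dP od erefl.
  have uw := vertex_word cP uP; have vw := vertex_word dP vP.
  have preu a : prefix_count u q a = prefix_count c.1 q a.
    by apply: vertex_prefix => //; apply: ltnW.
  have prev a : prefix_count v q a = prefix_count d.1 q a.
    apply: vertex_prefix => //; first exact: ltnW.
    by rewrite -(eqcl (widen_ord (leqnSn _) (Ordinal ltq))).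
  have : chain_elt c.1 p \in cell_of d p by rewrite -eqcd cE !inE eqxx.
  rewrite dE !inE => /orP [] /eqP /same.
    by apply=> // a lta; apply: pre => //; apply: ltnW.
  rewrite vq => /(_ cw vw) cd.
  have : chain_elt d.1 p \in cell_of c p by rewrite eqcd dE !inE eqxx.
  rewrite cE !inE => /orP [] /eqP /same.
    by move=> ->// a lta; rewrite pre // ltnW.
  rewrite uq => /(_ dw uw) dc.
  have {}cd: letter c.1 q = letter d.1 q.+1.
    by apply: cd => a lta; rewrite prev pre // ltnW.
  have {}dc: letter d.1 q = letter c.1 q.+1.
    by apply: dc => a lta; rewrite preu pre // ltnW.
  (* Otherwise both words would hold the same two letters at [q] in opposite orders, although each
     pair is decreasing. *)
  lia.
have pre' p a : a < n -> p <= len i -> prefix_count c.1 p a = prefix_count d.1 p a.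
  move=> lta lep; have [clp|] := boolP (closes c p); last exact: pre.
  case: p lep clp => // p lep /andP [_ /= op].
  rewrite !prefix_countS // pair // pre //; first exact: ltnW.
  by apply/negP => /(pword_closes cP) []; rewrite op.
case: c d {cP dP eqcd eqcl eqo pre pair cw dw} eq2 pre' => [c m] [d m'] /= -> pre.
congr (_, _); apply: eq_word => q ltq.
have := pre q.+1 (letter c q) (letter_lt _ ltq) ltq; rewrite !prefix_countS //.
by rewrite pre ?letter_lt ?(ltnW ltq) // eqxx => /addnI; case: eqP.
Qed.

(** * From cells back to parenthesized words *)

Definition rank (y : chain_prod i) : nat := \sum_j y j.

Lemma rank_leq y : rank y <= len i.
Proof. by apply: leq_sum => j _; rewrite -ltnS. Qed.

Lemma prod_lt_rank y z : prod_lt y z -> rank y < rank z.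
Proof.
case/andP=> /forallP le_yz; apply: contraNltn => le_zy.
have : \sum_j (z j - y j) = 0 by rewrite sumnB //; apply/eqP.
move/eqP; rewrite sum_nat_eq0 => /forallP eq_yz.
apply/eqP/ffunP=> j; apply/val_inj/eqP.
by rewrite eqn_leq le_yz /=; apply: (implyP (eq_yz j)).
Qed.

(** Ranks strictly increase along [len i + 1] elements and stay between 0 and [len i]: [lo] climbs
    from the bottom, [hi] descends from the top, and they meet. *)
Lemma rank_chain (x : {ffun 'I_(len i).+1 -> chain_prod i}) p :
  strictly_increasing x -> rank (x p) = p.
Proof.
move=> /forallP xP.
have xlt (a b : 'I_(len i).+1) : a < b -> rank (x a) < rank (x b).
  by move=> ltab; apply: prod_lt_rank; apply: (implyP (forallP (xP a) b)).
have lo k (ltk : k < (len i).+1) : k <= rank (x (Ordinal ltk)).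
  elim: k ltk => // k IH ltk; apply: leq_ltn_trans (IH (ltnW ltk)) _.
  exact: xlt.
have hi k (q : 'I_(len i).+1) : q + k = len i -> rank (x q) <= q.
  elim: k q => [|k IH] q qk; first by rewrite -[q : nat]addn0 qk rank_leq.
  have ltq : q.+1 < (len i).+1 by lia.
  have := IH (Ordinal ltq); have := @xlt q (Ordinal ltq); move=> /=; lia.
apply/eqP; rewrite eqn_leq; apply/andP; split; last first.
  by have := lo p (ltn_ord p); congr (_ <= rank (x _)); apply: val_inj.
by apply: (hi (len i - p)); rewrite subnKC // -ltnS.
Qed.

Lemma chain_word (x : {ffun 'I_(len i).+1 -> chain_prod i}) :
  strictly_increasing x ->
  exists2 w, is_word w & forall p, x p = chain_elt w p.
Proof.
move=> xP; have rk p := rank_chain p xP.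
have step (q : 'I_(len i)) : exists j : 'I_n, forall a,
    x (lift ord0 q) a = x (widen_ord (leqnSn _) q) a + (j == a) :> nat.
  set y := x (widen_ord _ _); set z := x _.
  have /andP [/forallP le_yz _] : prod_lt y z.
    by apply: (implyP (forallP (forallP xP _) _)); rewrite /= /bump.
  (* Since the rank rises by one, exactly one coordinate rises, by one; it is the letter of this
     step. *)
  have /eqP : \sum_j (z j - y j) = 1.
    by rewrite sumnB // -/(rank y) -/(rank z) !rk /= /bump; lia.
  case/sum_nat_eq1=> j [_ zj zN]; exists j => a.
  have := le_yz a; have [<-|ne_ja] := eqVneq j a; first lia.
  by have := zN a; rewrite eq_sym => /(_ ne_ja isT); lia.
have [f fP] := fin_all_exists step.
pose w : word i := [tuple f q | q < len i].
have wE (q : 'I_(len i)) : letter w q = f q by rewrite letter_tnth tnth_mktuple.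
have xE k (ltk : k < (len i).+1) (a : 'I_n) :
    x (Ordinal ltk) a = prefix_count w k a :> nat.
  elim: k ltk => [|k IH] ltk.
    rewrite prefix_count0; apply/eqP.
    have /eqP := rk (Ordinal ltk); rewrite sum_nat_eq0 => /forallP.
    by move/(_ a).
  have ltk' : k < len i by [].
  rewrite prefix_countS // -(IH (ltnW ltk)) -[k in letter _ k]/(val (Ordinal ltk')).
  rewrite wE val_eqE; have := fP (Ordinal ltk') a.
  have -> : lift ord0 (Ordinal ltk') = Ordinal ltk by apply: val_inj.
  by have -> : widen_ord (leqnSn _) (Ordinal ltk') = Ordinal (ltnW ltk)
    by apply: val_inj.
have ww : is_word w.
  have := rk ord_max; have -> : ord_max = Ordinal (ltnSn (len i)) by apply: val_inj.
  move=> /= rk_max; rewrite is_wordE; apply/forallP=> a; rewrite -(xE _ (ltnSn (len i))) eqn_leq.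
  rewrite -ltnS ltn_ord /= -subn_eq0.
  have /eqP : \sum_j (tnth i j - x (Ordinal (ltnSn (len i))) j) = 0.
    rewrite sumnB; last by move=> j _; rewrite -ltnS.
    by rewrite -/(rank _) rk_max subnn.
  by rewrite sum_nat_eq0 => /forallP /(_ a). 
exists w => // -[p ltp]; apply/ffunP=> a; apply: val_inj.
by rewrite /= chain_eltE // xE.
Qed.

Definition weight (y : chain_prod i) : nat := \sum_(j < n) j * y j.

Lemma weightS w q : is_word w -> q < len i ->
  weight (chain_elt w q.+1) = weight (chain_elt w q) + letter w q.
Proof.
move=> ww ltq; rewrite /weight.
under eq_bigr do rewrite chain_eltE // prefix_countS // mulnDr.
rewrite big_split /=; congr (_ + _).
  by apply: eq_bigr => j _; rewrite chain_eltE.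
rewrite (bigD1 (Ordinal (letter_lt w ltq))) //= eqxx muln1 big1 ?addn0 // => j ne.
by rewrite -val_eqE /= in ne; rewrite eq_sym (negPf ne) muln0.
Qed.

(* A cell is recovered by picking in each X_p the element of largest weight:
   these form a chain whose word has all its pairs in decreasing order. *)
Lemma Hom_encoded X : X \in Hom i -> exists2 c, is_pword c & X = cell_of c.
Proof.
rewrite inE => /andP [/forallP X0 /forallP XP].
have [f fP] : exists f : 'I_(len i).+1 -> chain_prod i,
    forall p, f p \in X p /\ forall y, y \in X p -> weight y <= weight (f p).
  have Xmax p : exists y, y \in X p /\ forall z, z \in X p -> weight z <= weight y.
    have /set0Pn [y0 y0X] := X0 p.
    by case: (@arg_maxnP _ y0 (mem (X p)) weight y0X) => y yX ymax; exists y.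
  exact: fin_all_exists Xmax.
have choice (z : {ffun 'I_(len i).+1 -> chain_prod i}) : (forall p, z p \in X p) ->
    exists2 w, is_word w & forall p, z p = chain_elt w p.
  by move=> zX; apply/chain_word/(implyP (XP z))/forallP.
have [|w ww fw] := choice [ffun p => f p]; first by move=> p; rewrite ffunE; case: (fP p).
have {}fw p : f p = chain_elt w p by rewrite -fw ffunE.
have wX p : chain_elt w (nat_of_ord p) \in X p by rewrite -fw; case: (fP p).
(* Replacing only the element of rank [p] by [y] gives another maximal chain, whose word is [w] with
   two adjacent letters exchanged. Maximal weight of [f p] forces [w] to be decreasing there. *)
have key (p : 'I_(len i).+1) y : y \in X p -> y <> chain_elt w p -> exists q,
    [/\ p = q.+1 :> nat, q.+1 < len i, letter w q.+1 < letter w q &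
     forall a : 'I_n, y a = prefix_count w q a + (letter w q.+1 == a) :> nat].
  move=> yX ney.
  have [|u uw uE] := choice [ffun p' => if p' == p then y else f p'].
    by move=> p'; rewrite ffunE; case: eqP => [->|_] //; case: (fP p').
  have uy : y = chain_elt u p by rewrite -uE ffunE eqxx.
  have pre p' a : p' <> p :> nat -> a < n -> p' < (len i).+1 ->
      prefix_count u p' a = prefix_count w p' a.
    move=> nep lta ltp; have := uE (Ordinal ltp).
    rewrite ffunE -val_eqE; case: eqP => // _; rewrite fw => /chain_elt_eq.
    by move=> /(_ ww uw a lta).
  have p0 : p <> 0 :> nat.
    by move=> p0; apply: ney; rewrite uy; apply/chain_elt_eq => // a _;
       rewrite p0 !prefix_count0.
  have pl : p <> len i :> nat.
    move=> pl; apply: ney; rewrite uy; apply/chain_elt_eq => // a lta.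
    move: uw ww; rewrite !is_wordE pl => /forallP /(_ (Ordinal lta)) /eqP /= ->.
    by move=> /forallP /(_ (Ordinal lta)) /eqP /= ->.
  have ltp := ltn_ord p.
  have [q pq] : exists q, p = q.+1 :> nat by exists p.-1; lia.
  have ltq1 : q.+1 < len i by lia.
  have ltq := ltnW ltq1.
  have preq a : a < n -> prefix_count u q a = prefix_count w q a.
    by move=> lta; apply: pre => //; lia.
  have neq : letter u q <> letter w q.
    move=> equw; apply: ney; rewrite uy; apply/chain_elt_eq => // a lta.
    by rewrite pq !prefix_countS // equw preq.
  have two a : a < n -> (letter u q == a) + (letter u q.+1 == a) =
      (letter w q == a) + (letter w q.+1 == a).
    move=> lta; have := pre q.+2 a; rewrite !prefix_countS // preq //; lia.
  have uq : letter u q = letter w q.+1.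
    have := two _ (letter_lt u ltq); lia.
  exists q; split=> //; last first.
    by move=> a; rewrite uy chain_eltE // pq prefix_countS // preq // uq.
  have := proj2 (fP p) y yX; rewrite fw uy pq !weightS //.
  have -> : chain_elt u q = chain_elt w q by apply/chain_elt_eq.
  by rewrite leq_add2l -uq; lia.
(* A pair opens at [q] exactly when X_(q+1) is not a singleton; [lift ord0 q] is the index
   [q.+1]. *)
pose c : pword i := (w, [tuple 1 < #|X (lift ord0 q)| | q < len i]).
have cX (p : 'I_(len i).+1) : 1 < #|X p| -> exists2 y, y \in X p & y <> chain_elt w p.
  rewrite (cardsD1 (chain_elt w p)) wX ltnS => /card_gt0P [y].
  by rewrite !inE => /andP [/eqP ney yX]; exists y.
have cl (p : 'I_(len i).+1) : closes c p = (1 < #|X p|).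
  case: (unliftP ord0 p) => [q ->|->]; last first.
    apply/esym/negP=> /cX [y yX ney].
    by have [q []] := key _ _ yX ney.
  have : opens c q = (1 < #|X (lift ord0 q)|) by rewrite /opens -tnth_nth tnth_mktuple.
  exact.
have cP : is_pword c.
  rewrite /is_pword ww /=; apply/forallP=> q; apply/implyP=> oq.
  have : 1 < #|X (lift ord0 q)| by rewrite -cl.
  case/cX=> y yX ney; have [q' [q'E ltq1 ltl yE]] := key _ _ yX ney.
  have {q'E} q'E : q' = q by case: q'E.
  subst q'.
  rewrite ltq1 ltl; apply/negP=> oq1.
  have : 1 < #|X (lift ord0 (Ordinal ltq1))| by rewrite -cl.
  case/cX=> z zX nez; have [q' [q'E ltq2 ltl1 zE]] := key _ _ zX nez.
  have {q'E} q'E : q' = q.+1 by case: q'E.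
  subst q'.
  pose p := lift ord0 q; pose p1 := lift ord0 (Ordinal ltq1).
  have [|v vw vE] := choice [ffun p' => if p' == p then y
                                        else if p' == p1 then z else f p'].
    move=> p'; rewrite ffunE; case: eqP => [->|_] //.
    by case: eqP => [->|_] //; case: (fP p').
  have vy : chain_elt v p = y by rewrite -vE ffunE eqxx.
  have vz : chain_elt v p1 = z.
    by rewrite -vE ffunE eqxx -val_eqE /= /bump /= ifN //; lia.
  (* If two pairs overlapped, three consecutive letters would strictly decrease. Choosing both
     alternatives [y] and [z] at once would then make the coordinate of the middle letter drop by
     one along a chain. *)
  pose a := Ordinal (letter_lt w ltq1).
  have := @prefix_count_leq v q.+1 q.+2 a (leqnSn _).
  rewrite -[X in X <= _](chain_eltE p) // -[X in _ <= X](chain_eltE p1) // vy vz.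
  by rewrite yE zE prefix_countS //=; lia.
exists c => //; apply/ffunP=> p; have [clp|nclp] := boolP (closes c p); last first.
  rewrite cell_of_free //; apply/setP=> y; rewrite inE; apply/idP/eqP => [yX|->//].
  apply/eqP; apply: contraNT nclp => /eqP ney; rewrite cl.
  by rewrite (cardsD1 y) yX ltnS; apply/card_gt0P; exists (chain_elt w p);
     rewrite !inE wX andbT; apply/eqP/nesym.
have /andP [p_gt0 op] := clp.
have [u [uP uq -> neq]] := cell_of_pair cP op (esym (prednK p_gt0)).
have := clp; rewrite cl => /cX [y yX ney].
have ncl : ~~ closes c p.-1 by apply/negP => /(pword_closes cP) []; rewrite op.
(* By [key] the coordinates of a second element are determined by [w], so X_p has at most two
   elements. *)
have uE z : z \in X p -> z <> chain_elt w p -> z = chain_elt u p.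
  move=> zX nez; have [q [pq ltq1 _ zE]] := key _ _ zX nez.
  have uw := vertex_word cP uP.
  apply/ffunP=> a; apply: val_inj; rewrite /= zE chain_eltE // pq.
  move: uq ncl; rewrite pq /= => uq ncl.
  rewrite prefix_countS ?(ltnW ltq1) // uq (vertex_prefix _ cP uP) //.
  by do 2!apply: ltnW.
apply/setP=> z; rewrite !inE; apply/idP/orP => [zX|[]/eqP -> //]; last first.
  by rewrite -(uE y).
by have [->|/eqP nez] := eqVneq z (chain_elt w p); [left|right; apply/eqP/uE].
Qed.

End Encoding.

(** * Critical cells as words with no type-a position *)

Section Critical.

Variables (n : nat) (i : n.-tuple nat).
Implicit Types (w : word i) (c : pword i) (X : hom_tuple i).

(** Being of type a does not depend on the current set Omega, so the successive removals amount to
    one conjunction over all steps. *)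
Lemma in_critical_cells X : (X \in critical_cells i) =
  (X \in Hom i) && all (fun rs => ~~ type_a rs.1 rs.2 X) (steps i).
Proof.
rewrite /critical_cells; elim: (steps i) (Hom i) => [|rs l IH] Om /=.
  by rewrite andbT.
by rewrite IH inE andbA.
Qed.

(** By [cell_of_inj] the code that [type_a] quantifies over is unique. *)
Lemma type_a_cell_of c (r : 'I_n) s : is_pword c ->
  type_a r s (cell_of c) = type_a_pword r s c.
Proof.
move=> cP; apply/existsP/idP => [[d /andP [/andP [dP /eqP eqcd]]]|ac].
  by rewrite (cell_of_inj cP dP eqcd).
by exists c; rewrite /encodes cP eqxx.
Qed.

Definition type_a_at c j :=
  [&& (0 < j) && free c j.-1 ==> (letter c.1 j.-1 <= letter c.1 j),
      (j.+1 < len i) && (letter c.1 j.+1 < letter c.1 j)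
    & free c j && free c j.+1 || opens c j].

Lemma size_occurrences w (r : 'I_n) : is_word w ->
  size [seq q <- iota 0 (len i) | letter w q == r] = tnth i r.
Proof.
move=> /forallP /(_ r) /eqP <-; rewrite size_filter.
transitivity (count_mem (val r) (map val w)); last first.
  by rewrite count_map; apply: eq_count => x /=.
rewrite -[map val w](mkseq_nth n) /mkseq count_map size_letters.
exact: eq_count.
Qed.

(** Each position holds some occurrence of its letter, so running through the pairs (r, s) runs
    through all positions. *)
Lemma type_a_steps c : is_pword c ->
  reflect (forall q, q < len i -> ~~ type_a_at c q)
          (all (fun rs => ~~ type_a rs.1 rs.2 (cell_of c)) (steps i)).
Proof.
move=> cP; have cw := pword_word cP.
apply: (iffP allP) => [cA q ltq|cA rs].
  pose r := Ordinal (letter_lt c.1 ltq).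
  pose occ := [seq q <- iota 0 (len i) | letter c.1 q == r].
  have qocc : q \in occ by rewrite mem_filter mem_iota /= eqxx ltq.
  have szocc : size occ = tnth i r by apply: size_occurrences.
  have : (r, (index q occ).+1) \in steps i.
    apply: allpairs_f_dep; rewrite mem_rev ?mem_enum // mem_iota add1n ltnS -szocc.
    by rewrite ltnS index_mem.
  move/cA; rewrite type_a_cell_of //= /type_a_pword /occ_pos /=.
  by rewrite -/occ nth_index.
case/allpairsPdep=> r [s [_]]; rewrite mem_rev mem_iota => /andP [s_gt0 les] ->.
rewrite type_a_cell_of //= /type_a_pword.
set j := occ_pos _ _ _.
have : j \in [seq q <- iota 0 (len i) | letter c.1 q == r].
  by rewrite mem_nth // size_occurrences //; lia.
rewrite mem_filter mem_iota => /andP [/eqP <- /andP [_ ltj]].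
exact: cA.
Qed.

Lemma critical_cells_dim k : [set X in critical_cells i | cell_dim X == k] =
  (@cell_of n i) @: [set c | [&& is_pword c,
     [forall q : 'I_(len i), ~~ type_a_at c q] & count id c.2 == k]].
Proof.
apply/setP=> X; rewrite inE in_critical_cells; apply/idP/imsetP.
  case/andP=> /andP [/Hom_encoded [c cP ->] /(type_a_steps cP) cA] dimX.
  exists c => //; rewrite inE cP -cell_dim_cell_of // dimX andbT.
  by apply/forallP=> q; apply: cA.
case=> c; rewrite inE => /and3P [cP /forallP cA dimc] ->.
rewrite cell_of_Hom // cell_dim_cell_of // dimc andbT.
by apply/(type_a_steps cP) => q ltq; apply: (cA (Ordinal ltq)).
Qed.

End Critical.

(** * Critical words on three letters as token sequences *)

(* A letter together with the flag telling that it opens a pair. *)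
Definition token : Type := (nat * bool)%type.

(* The letter closing a pair is 0, which imposes no more on its successor than
   the beginning of the word does; hence no third kind of token is needed. *)
Definition tok_step (x y : token) : bool :=
  if x.2 then y == (0, false)
  else if y.2 then (x.1 == 2) && (y.1 == 1)
  else x.1 <= y.1.

Definition tokens n (i : n.-tuple nat) (c : pword i) : seq token :=
  zip (map val c.1) c.2.

Lemma size_tokens n (i : n.-tuple nat) (c : pword i) : size (tokens c) = len i.
Proof. by rewrite size_zip !size_tuple minnn. Qed.

Lemma nth_tokens n (i : n.-tuple nat) (c : pword i) q : q < len i ->
  nth (0, false) (tokens c) q = (letter c.1 q, opens c q).
Proof.
move=> ltq; rewrite /tokens nth_zip ?size_map ?size_tuple //.
by rewrite /letter (set_nth_default n) // size_map size_tuple.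
Qed.

Section ThreeLetters.

Variable i : 3.-tuple nat.
Implicit Types (c : pword i).

(** The preceding token [p] is a parameter so that words can be counted by recursion on their first
    token; the condition on the last token excludes a pair left unclosed. *)
Definition critical_tokens (p : token) (w : seq token) : bool :=
  path tok_step p w && ~~ (last p w).2.

Lemma critical_tokensP c :
  reflect ([/\ forall q, q.+1 < len i -> tok_step (letter c.1 q, opens c q)
                 (letter c.1 q.+1, opens c q.+1),
              ~~ opens c 0 &
              ~~ opens c (len i).-1])
    (critical_tokens (0, false) (tokens c)).
Proof.
have lastE : (last (0, false) (tokens c)).2 = opens c (len i).-1.
  rewrite -nth_last size_tokens; case: (posnP (len i)) => [l0|lgt].
    by rewrite nth_default ?size_tokens ?l0 // /opens nth_default // size_tuple l0.
  by rewrite nth_tokens // ltn_predL.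
apply: (iffP andP) => [[/(pathP (0, false)) cP]|[cS c0 cl]].
  rewrite lastE => cl; split=> //.
    move=> q ltq; have := cP q.+1; rewrite size_tokens => /(_ ltq) /=.
    by rewrite !nth_tokens // ltnW.
  case: (posnP (len i)) => [l0|lgt]; first by rewrite /opens nth_default // size_tuple l0.
  have := cP 0; rewrite size_tokens => /(_ lgt) /=; by rewrite nth_tokens // /tok_step /=; case: (opens c 0).
rewrite lastE; split=> //; apply/(pathP (0, false)) => -[|q]; rewrite size_tokens => ltq.
  by rewrite /= nth_tokens // /tok_step /= (negPf c0).
by rewrite /= !nth_tokens ?(ltnW ltq) //; apply: cS.
Qed.

Lemma critical_pwordE c :
  is_pword c && [forall q : 'I_(len i), ~~ type_a_at c q] =
  is_word c.1 && critical_tokens (0, false) (tokens c).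
Proof.
apply/idP/idP.
  case/andP=> cP /forallP cA; rewrite pword_word //=.
  have {}cA q : q < len i -> ~~ type_a_at c q.
    by move=> ltq; apply: (cA (Ordinal ltq)).
  (* At an opening letter only condition (1) of type a can fail, so a larger free letter precedes
     the pair; three strictly decreasing letters below 3 are 2, 1, 0. *)
  have pair q : opens c q -> [/\ 0 < q, free c q.-1, letter c.1 q.-1 = 2,
      letter c.1 q = 1 & letter c.1 q.+1 = 0].
    move=> oq; have /and3P [ltq1 ltl nq1] := pword_opens cP oq.
    have := cA q (ltnW ltq1); rewrite /type_a_at ltq1 ltl oq orbT /= !andbT.
    rewrite negb_imply -ltnNge => /andP [/andP [q_gt0 fq] ltp].
    have ltq' : q.-1 < len i by lia.
    have lt3 := letter_lt c.1 ltq'; split=> //; move: ltl ltp lt3;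
      by move: (letter c.1 q.+1) (letter c.1 q) (letter c.1 q.-1) => x y z; lia.
  (* A free descent that is not of type a is preceded by a larger free letter, hence by another free
     descent one place to the left. *)
  have mono q : q.+1 < len i -> free c q -> free c q.+1 ->
      letter c.1 q <= letter c.1 q.+1.
    elim: q => [|q IH] ltq1 fq fq1; rewrite leqNgt; apply/negP=> desc;
      have := cA _ (ltnW ltq1); rewrite /type_a_at ltq1 desc fq fq1 //=.
    by rewrite andbT negb_imply -ltnNge => /andP [fq0]; rewrite ltnNge IH // ltnW.
  apply/critical_tokensP; split=> [q ltq1||]; last first.
  - apply/negP => /(pword_opens cP) /and3P []; lia.
  - by apply/negP=> /pair [].
  rewrite /tok_step /=; case: ifP => [oq|noq].
    have [_ _ _ _ ->] := pair _ oq.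
    by have /and3P [_ _ /negPf ->] := pword_opens cP oq.
  case: ifP => [oq1|noq1]; first by have [_ _ /= -> -> _] := pair _ oq1.
  (* A closing letter is 0, so the letter after it is automatically at least as large. *)
  have [/andP [q_gt0 oq']|nclq] := boolP (closes c q).
    by have [_ _ _ _] := pair _ oq'; rewrite prednK // => ->.
  by apply: mono; rewrite /free // ?noq ?noq1 ?nclq // /closes /= noq.
case/andP=> cw /critical_tokensP [cS c0 cl].
have pair q : opens c q -> [/\ 0 < q, q.+1 < len i, free c q.-1, letter c.1 q.-1 = 2 &
      letter c.1 q = 1] /\ letter c.1 q.+1 = 0 /\ ~~ opens c q.+1.
  move=> oq; have ltq := opens_lt oq.
  case: q oq ltq => [|q] oq ltq; first by rewrite oq in c0.
  have ltq2 : q.+2 < len i.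
    rewrite ltn_neqAle ltq andbT; apply: contraNneq cl => <-; exact: oq.
  have := cS _ ltq2; rewrite /tok_step /= oq => /eqP [-> ->].
  have := cS _ ltq; rewrite /tok_step /= oq; case: ifP => [_ /eqP []//|noq].
  case/andP=> /eqP q2 /eqP q1; split=> //; split=> //.
  (* The 2 in front of a pair cannot close an earlier pair, since closing letters are 0. *)
  rewrite /free noq /=; apply/negP=> /andP [q_gt0 oq'].
  case: q q_gt0 oq' ltq q2 {oq ltq2 noq q1} => // q _ /= oq ltq q2.
  by have := cS _ (ltnW ltq); rewrite /tok_step /= oq q2.
apply/andP; split.
  rewrite /is_pword cw; apply/forallP=> q; apply/implyP=> oq.
  by have [[_ -> _ _ ->] [-> ->]] := pair _ oq.
apply/forallP=> q; apply/negP=> /and3P [].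
(* A free descent contradicts [tok_step]; at an opening letter, condition (1) would read 2 <= 1. *)
move=> up /andP [ltq1 desc] /orP [/andP [fq fq1]|oq].
  have := cS _ ltq1; rewrite /tok_step /=.
  by rewrite !(negPf (proj1 (andP fq))) (negPf (proj1 (andP fq1))) leqNgt desc.
have [[q_gt0 _ fq q2 q1] _] := pair _ oq.
by move: up; rewrite q_gt0 fq q2 q1.
Qed.

End ThreeLetters.

(** * Counting token sequences *)

Definition alphabet : seq token := [seq (x, b) | x <- iota 0 3, b <- [:: false; true]].

Fixpoint token_words m : seq (seq token) :=
  if m is m'.+1 then [seq x :: w | x <- alphabet, w <- token_words m'] else [:: [::]].

Lemma mem_token_words m w :
  (w \in token_words m) = (size w == m) && all (mem alphabet) w.
Proof.
elim: m w => [|m IH] [|x w] //.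
  by apply/negP=> /allpairsP [[]] ? ? [].
rewrite [RHS]/= eqSS andbCA -IH; apply/allpairsP/andP.
  by case=> -[y v] [/= yA vW [-> ->]].
by case=> xA wW; exists (x, w).
Qed.

Lemma token_words_uniq m : uniq (token_words m).
Proof.
elim: m => // m IH; apply: allpairs_uniq => // -[x w] [y v] _ _ /= [-> ->] //.
Qed.

(** [tokens] is a bijection onto the sequences of length [len i] over [alphabet]. This moves the
    count to lists, where recursion on the length is possible. *)
Lemma count_tokens (i : 3.-tuple nat) (P : pred (seq token)) :
  #|[set c : pword i | P (tokens c)]| = count P (token_words (len i)).
Proof.
transitivity (count P [seq tokens c | c : pword i]).
  by rewrite cardsE cardE size_filter count_map enumT.
apply/permP/uniq_perm; last 1 first.
- move=> w; rewrite mem_token_words; apply/mapP/andP.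
    case=> c _ ->; rewrite size_tokens; split=> //.
    apply/(all_nthP (0, false)) => q; rewrite size_tokens => ltq.
    rewrite nth_tokens //; apply/allpairsP; exists (letter c.1 q, opens c q) => /=.
    split=> //; last by case: (opens c q).
    by have := letter_lt c.1 ltq; case: (letter c.1 q) => [|[|[|]]].
  case=> /eqP szw /allP wA.
  have sz1 : size [seq inord x.1 : 'I_3 | x <- w] == len i by rewrite size_map szw.
  have sz2 : size (map snd w) == len i by rewrite size_map szw.
  exists (Tuple sz1, Tuple sz2); first by rewrite mem_enum.
  rewrite /tokens /= -map_comp.
  rewrite -[LHS](zip_unzip w); congr zip; apply/eq_in_map => x /wA.
  by case/allpairsP=> -[a b] /= [aA _ ->]; rewrite inordK //; move: a aA => [|[|[|]]].
- rewrite map_inj_uniq ?enum_uniq // => -[w m] [v m'] eqt.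
  have szE (c : pword i) : size (map val c.1) = size c.2 by rewrite size_map !size_tuple.
  have e1 : map val w = map val v.
    have := congr1 unzip1 eqt; rewrite !unzip1_zip ?szE //=;
    by rewrite ?size_map ?size_tuple.
  have e2 : m = m' :> seq bool.
    have := congr1 unzip2 eqt; rewrite !unzip2_zip //=;
    by rewrite ?size_map ?size_tuple.
  by congr (_, _); apply: val_inj => //=; apply: (inj_map val_inj).
exact: token_words_uniq.
Qed.

Definition tally (p : token) (r s t k : nat) (w : seq token) : bool :=
  [&& critical_tokens p w, count (fun x => x.1 == 0) w == r,
      count (fun x => x.1 == 1) w == s, count (fun x => x.1 == 2) w == t
    & count snd w == k].

Lemma count_tally_cons p x r s t k W :
  count (tally p r s t k) (map (cons x) W) =
  if [&& tok_step p x, (x.1 == 0) <= r, (x.1 == 1) <= s, (x.1 == 2) <= t & x.2 <= k]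
  then count (tally x (r - (x.1 == 0)) (s - (x.1 == 1)) (t - (x.1 == 2)) (k - x.2)) W
  else 0.
Proof.
rewrite count_map; case: ifP => [/and5P [px lr ls lt lk]|npx].
  apply: eq_count => w; rewrite /= /tally /critical_tokens /= px /=.
  by congr [&& _, _, _, _ & _]; lia.
rewrite -(count_pred0 W); apply: eq_count => w; apply: contraFF npx.
rewrite /= /tally /critical_tokens /= => /and5P [/andP [/andP [-> _] _]]; lia.
Qed.

(* 'C(a - 1, k - 1), with the conventions at 0 that make
   'C(a, k) = [0 < a] 'C(a - 1, k) + bin_pred a k hold. *)
Definition bin_pred a k :=
  match a, k with 0, 0 => 1 | a'.+1, k'.+1 => 'C(a', k') | _, _ => 0 end.

(** Closed forms for the number of ways to continue after [p] with [r], [s], [t] letters and [k]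
    openings still to place. The default 0 covers [(0, true)] and [(2, true)], which no step
    reaches. *)
Definition tally_count (p : token) r s t k :=
  match p with
  | (0, false) => 'C(r, k) * 'C(s, k) * 'C(t, k)
  | (1, false) => bin_pred r k * 'C(s, k) * 'C(t, k)
  | (2, false) => bin_pred r k * bin_pred s k * 'C(t.+1, k)
  | (1, true) => if r is r'.+1 then 'C(r', k) * 'C(s, k) * 'C(t, k) else 0
  | _ => 0
  end.

(** Splitting on the first token gives one recurrence per state, each settled by Pascal's rule.
    After a 2, for instance, the next token is a free 2 or the opening 1, matching 'C(t+1, k) =
    'C(t, k) + 'C(t, k-1). *)
Lemma count_tally m p r s t k :
  p \in [:: (0, false); (1, false); (2, false); (1, true)] -> m = r + s + t ->
  count (tally p r s t k) (token_words m) = tally_count p r s t k.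
Proof.
elim: m p r s t k => [|m IH] p r s t k.
  move=> pA /esym /eqP; rewrite !addn_eq0 => /andP [/andP [/eqP -> /eqP ->] /eqP ->].
  by move: pA; rewrite !inE => /or4P [] /eqP ->; case: k => [|k].
move=> pA mE.
rewrite [token_words _]/= !cats0 !count_cat !count_tally_cons.
move: pA; rewrite !inE => /or4P [] /eqP -> /=;
  case: r s t mE => [|r] [|s] [|t] mE; case: k => [|k];
  rewrite ?subSS ?subn0 /= ?IH //=; try lia; rewrite ?binS ?bin0n ?bin0; nia.
Qed.

Theorem theorem6p1 (r s t k : nat) (r_gt0 : 0 < r) (le_rs : r <= s)
    (le_st : s <= t) (le_kr : k <= r) :
  #|[set X in critical_cells [tuple r; s; t] | cell_dim X == k]|
    = 'C(r, k) * 'C(s, k) * 'C(t, k).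
Proof.
set i := [tuple r; s; t].
have lenE : len i = r + s + t by rewrite /len !big_ord_recl big_ord0 /= addn0 addnA.
rewrite critical_cells_dim card_in_imset; last first.
  by move=> c d; rewrite !inE => /andP [cP _] /andP [dP _]; apply: cell_of_inj.
(* The start of the word acts as a free 0: any free letter may follow it, but no pair may open. *)
rewrite -[RHS]/(tally_count (0, false) r s t k) -(@count_tally (len i)) // -count_tokens.
congr #|pred_of_set _|; apply/setP=> c; rewrite !inE andbA critical_pwordE.
rewrite /tally.
have sz : size (map val c.1) = size c.2 by rewrite size_map !size_tuple.
have letE a : count (fun x : token => x.1 == a) (tokens c) = count_mem a (map val c.1).
  by rewrite -[in RHS](@unzip1_zip _ _ (map val c.1) c.2) ?sz // count_map.
have -> : count snd (tokens c) = count id c.2.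
  by rewrite -[in RHS](@unzip2_zip _ _ (map val c.1) c.2) ?sz // count_map.
rewrite !letE; case: (critical_tokens _ _); rewrite ?andbF // andbT /= !andbA.
congr (_ && _).
have wE (j : 'I_3) : count_mem j c.1 = count_mem (val j) (map val c.1).
  by rewrite count_map; apply: eq_count.
rewrite /is_word; apply/forallP/andP => [cw|[/andP [c0 c1] c2] j]; rewrite ?wE.
  have := cw ord0; have := cw (lift ord0 ord0); have := cw (lift ord0 (lift ord0 ord0)).
  by rewrite !wE => -> -> ->.
by case: j => -[|[|[|]]].
Qed.
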